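(* Let $\mathcal{G}=(V,E)$ be a graph equipped with an adapted complex structure $J$, and let $a\in E$ be a non-distinguished edge in $\mathcal{G}$, joining the vertices $x$ and $y$. Then $Ja$ is, up to sign, another non-distinguished edge in $\mathcal{G}$ that is adjacent to $a$; more precisely, at least one of $Jx$ or $Jy$ is, up to sign, a non-isolated vertex, and $Ja$ (up to sign) joins $x$ with $Jy$ (up to sign), or $y$ with $Jx$ (up to sign).
   Context: Graphs are finite and simple. Two edges are adjacent if they share a common vertex; a vertex is isolated if its degree is $0$. For a graph $\mathcal{G}=(V,E)$ label $V=\{v_1,\dots,v_n\}$ and write $e_{i,j}$ ($i<j$) for the edge joining $v_i$ and $v_j$, if it exists. The Lie algebra $\mathfrak{n}_{\mathcal{G}}$ is the real vector space with basis $V\cup E$ and Lie bracket $[v_i,v_j]=e_{i,j}$ for $i<j$ if $v_i,v_j$ are adjacent, $[v_i,v_j]=0$ if they are not adjacent, and all elements of $E$ central. A complex structure on a real Lie algebra $\mathfrak{g}$ is a linear map $J:\mathfrak{g}\to\mathfrak{g}$ with $J^2=-\mathrm{Id}$ and $[x,y]+J([Jx,y]+[x,Jy])-[Jx,Jy]=0$ for all $x,y\in\mathfrak{g}$. An adapted complex structure on the graph $\mathcal{G}$ is a complex structure $J$ on $\mathfrak{n}_{\mathcal{G}}$ such that for every $x\in V\cup E$ either $Jx\in V\cup E$ or $-Jx\in V\cup E$. An edge is distinguished if it joins a pair of vertices $v,w$ with $w=Jv$. ''$Jx$ is, up to sign, a vertex (edge)'' means that $Jx$ or $-Jx$ belongs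 to $V$ (to $E$). *)

(* Defs.v *)
From mathcomp Require Import all_boot all_order all_algebra.
From mathcomp Require Import reals.

Set Implicit Arguments.
Unset Strict Implicit.
Unset Printing Implicit Defensive.

Import Order.TTheory GRing.Theory Num.Theory.
Local Open Scope ring_scope.

Record graph (n : nat) := Graph {
  adj : rel 'I_n;
  adj_sym : symmetric adj;
  adj_irr : irreflexive adj
}.

Definition edge_pair n (G : graph n) : pred ('I_n * 'I_n) :=
  fun p => (p.1 < p.2)%N && adj G p.1 p.2.

(* The pair (i, j) with i < j stands for e_{i,j}, so that every unordered edge
   has exactly one representative. *)
Definition edge n (G : graph n) : finType := {p | edge_pair G p}.

Definition degree n (G : graph n) (v : 'I_n) : nat := #|[set w | adj G v w]|.

Definition isolated n (G : graph n) (v : 'I_n) : Prop := degree G v = 0%N.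

Definition joins n (G : graph n) (a : edge G) (v w : 'I_n) : Prop :=
  val a = (v, w) \/ val a = (w, v).

Definition incident n (G : graph n) (a : edge G) (v : 'I_n) : Prop :=
  v = (val a).1 \/ v = (val a).2.

Definition edges_adjacent n (G : graph n) (a b : edge G) : Prop :=
  exists v, incident a v /\ incident b v.

Record lieAlgebra (R : realType) := LieAlgebra {
  lie_space :> lmodType R;
  lie : lie_space -> lie_space -> lie_space;
  lie_linearl : forall z, linear (fun x => lie x z);
  lie_linearr : forall x, linear (lie x);
  lie_alt : forall x, lie x x = 0;
  lie_jacobi : forall x y z,
    lie x (lie y z) + lie y (lie z x) + lie z (lie x y) = 0
}.

Definition complex_structure (R : realType) (g : lieAlgebra R)
    (J : {linear g -> g}) : Prop :=
  (forall x : g, J (J x) = - x) /\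
  (forall x y : g,
     lie x y + J (lie (J x) y + lie x (J y)) - lie (J x) (J y) = 0).

Definition bidx n (G : graph n) : finType := ('I_n + edge G)%type.

Definition graph_space (R : realType) n (G : graph n) : lmodType R :=
  {ffun bidx G -> R^o}.

Definition bvec (R : realType) n (G : graph n) (b : bidx G) :
    graph_space R G := [ffun c => (c == b)%:R].

(* [insub (i, j) : option (edge G)] is the edge e_{i,j} when i < j and
   v_i, v_j are adjacent, and None otherwise; the second test supplies
   [v_i, v_j] = - e_{j,i} for j < i. *)
Definition bracket_basis (R : realType) n (G : graph n) (b c : bidx G) :
    graph_space R G :=
  match b, c with
  | inl i, inl j =>
      if (insub (i, j) : option (edge G)) is Some a then bvec R (inr a)
      else if (insub (j, i) : option (edge G)) is Some a then - bvec R (inr a)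
      else 0
  | _, _ => 0
  end.

Definition graph_bracket (R : realType) n (G : graph n)
    (f g : graph_space R G) : graph_space R G :=
  \sum_b \sum_c (f b * g c) *: bracket_basis R b c.

Section GraphLie.
Variables (R : realType) (n : nat) (G : graph n).
Local Notation br := (@graph_bracket R n G).

Lemma graph_bracket_linearl z : linear (fun x => br x z).
Proof.
move=> k x y; rewrite /graph_bracket scaler_sumr -big_split /=.
apply: eq_bigr => b _; rewrite scaler_sumr -big_split /=.
apply: eq_bigr => c _; rewrite !ffunE scalerA -scalerDl mulrA -mulrDl.
by [].
Qed.

Lemma graph_bracket_linearr x : linear (br x).
Proof.
move=> k y z; rewrite /graph_bracket scaler_sumr -big_split /=.
apply: eq_bigr => b _; rewrite scaler_sumr -big_split /=.
apply: eq_bigr => c _; rewrite !ffunE scalerA -scalerDl mulrCA -mulrDr.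
by [].
Qed.

Lemma graph_bracket_bvec b c :
  br (bvec R b) (bvec R c) = bracket_basis R b c.
Proof.
rewrite /graph_bracket (bigD1 b) //= (bigD1 c) //= !ffunE !eqxx mulr1 scale1r.
rewrite !big1 ?addr0 // => [b' /negPf nb | c' /negPf nc].
  by rewrite big1 // => c' _; rewrite ffunE nb mul0r scale0r.
by rewrite ffunE nc mulr0 scale0r.
Qed.

Lemma bracket_basis_anti (b c : bidx G) :
  bracket_basis R b c = - bracket_basis R c b.
Proof.
case: b c => [i|a] [j|a'] /=; rewrite ?oppr0 //.
case: insubP => [u /andP[/= ij _] _|nij]; case: insubP => [v /andP[/= ji _] _|nji].
- by have := ltn_trans ij ji; rewrite ltnn.
- by rewrite opprK.
- by [].
- by rewrite oppr0.
Qed.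

Lemma graph_bracket_alt x : br x x = 0.
Proof.
have anti : br x x = - br x x.
  rewrite {1}/graph_bracket exchange_big /= -sumrN; apply: eq_bigr => b _.
  rewrite -sumrN; apply: eq_bigr => c _.
  by rewrite bracket_basis_anti scalerN mulrC.
have /eqP : br x x *+ 2 = 0 by rewrite mulr2n {1}anti addNr.
rewrite -scaler_nat scaler_eq0 pnatr_eq0 /=.
by move=> /eqP.
Qed.

Lemma graph_bracket_vertex x y (i : 'I_n) : br x y (inl i) = 0.
Proof.
rewrite /graph_bracket sum_ffunE big1 // => b _.
rewrite sum_ffunE big1 // => c _.
rewrite ffunE; suff -> : bracket_basis R b c (inl i) = 0 by rewrite scaler0.
case: b c => [k|a] [l|a'] /=; rewrite ?ffunE //.
by case: insubP => [u _ _|_]; [|case: insubP => [u _ _|_]]; rewrite !ffunE ?oppr0.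
Qed.

Lemma graph_bracket_central x y z : br x (br y z) = 0.
Proof.
rewrite {1}/graph_bracket big1 // => b _; rewrite big1 // => -[i|a] _.
  by rewrite graph_bracket_vertex mulr0 scale0r.
by case: b => [k|a'] /=; rewrite scaler0.
Qed.

Lemma graph_bracket_jacobi x y z :
  br x (br y z) + br y (br z x) + br z (br x y) = 0.
Proof. by rewrite !graph_bracket_central !addr0. Qed.

Definition graph_lie : lieAlgebra R :=
  LieAlgebra graph_bracket_linearl graph_bracket_linearr
    graph_bracket_alt graph_bracket_jacobi.

End GraphLie.

Definition vvec (R : realType) n (G : graph n) (v : 'I_n) : graph_lie R G :=
  bvec R (inl v : bidx G).

Definition evec (R : realType) n (G : graph n) (a : edge G) : graph_lie R G :=
  bvec R (inr a : bidx G).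

Definition eq_upto_sign (R : realType) (g : lieAlgebra R) (x y : g) : Prop :=
  x = y \/ - x = y.

Definition adapted_complex_structure (R : realType) n (G : graph n)
    (J : {linear graph_lie R G -> graph_lie R G}) : Prop :=
  complex_structure J /\
  (forall b : bidx G, exists c : bidx G,
     eq_upto_sign (J (bvec R b)) (bvec R c : graph_lie R G)).

Definition distinguished (R : realType) n (G : graph n)
    (J : {linear graph_lie R G -> graph_lie R G}) (a : edge G) : Prop :=
  exists v w : 'I_n, joins a v w /\ vvec R G w = J (vvec R G v).

(* Main.v *)
Require Import Defs.
From mathcomp Require Import all_boot all_order all_algebra.
From mathcomp Require Import reals.

(** Applying [J] to the integrability condition for [x], [y] gives
    [J [x,y] = [Jx,y] + [x,Jy] + J [Jx,Jy]].  Since [a] is not distinguished,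
    [Jx] and [Jy] do not span the edge [a], so the last term does not involve
    the basis element [d = ± Ja], by injectivity of [J].  Hence [d] occurs in
    [[Jx,y]] or in [[x,Jy]], which makes it an edge and [Jx], respectively
    [Jy], a vertex up to sign. *)

Set Implicit Arguments.
Unset Strict Implicit.
Unset Printing Implicit Defensive.

Import Order.TTheory GRing.Theory Num.Theory.
Local Open Scope ring_scope.

(** * Edges and their endpoints *)

Section Graph.
Variables (n : nat) (G : graph n).
Implicit Types (a e : edge G) (x y : 'I_n).

Lemma joins_sym a x y : joins a x y -> joins a y x.
Proof. by case=> ?; [right|left]. Qed.

Lemma joins_adj a x y : joins a x y -> adj G x y.
Proof.
by case: a => -[i j] /= p; have /andP[_ /= Aij] := p; case=> -[<- <-] //;
  rewrite adj_sym.
Qed.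

Lemma joins_neq a x y : joins a x y -> x <> y.
Proof. by move=> /joins_adj Axy exy; move: Axy; rewrite exy adj_irr. Qed.

Lemma joins_not_isolated a x y : joins a x y -> ~ isolated G x.
Proof.
move=> /joins_adj Axy /eqP; rewrite /degree cards_eq0 => /eqP/setP/(_ y).
by rewrite !inE Axy.
Qed.

Lemma joins_incident a x y : joins a x y -> incident a x.
Proof. by rewrite /incident; case=> ->; [left|right]. Qed.

Lemma joins_ends a x y i j :
  joins a x y -> joins a i j -> (i = x /\ j = y) \/ (i = y /\ j = x).
Proof.
by rewrite /joins; case=> ->; case=> -[-> ->]; [left|right|right|left].
Qed.

End Graph.

Lemma lieZl (R : realType) (g : lieAlgebra R) k (u v : g) :
  lie (k *: u) v = k *: lie u v.
Proof. exact: (scalable_linear (lie_linearl v) k u). Qed.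

Lemma lieZr (R : realType) (g : lieAlgebra R) k (u v : g) :
  lie u (k *: v) = k *: lie u v.
Proof. exact: (scalable_linear (lie_linearr u) k v). Qed.

(** * Coordinates and brackets of basis vectors *)

Section Basis.
Variables (R : realType) (n : nat) (G : graph n).
Local Notation g := (graph_lie R G).
Implicit Types (b c d : bidx G).

Definition basis b : g := bvec R b.
Definition coord (u : g) b : R := (u : {ffun bidx G -> R^o}) b.

Lemma coordD u v b : coord (u + v) b = coord u b + coord v b.
Proof. exact: ffunE. Qed.

Lemma coordZ k u b : coord (k *: u) b = k * coord u b.
Proof. exact: ffunE. Qed.

Lemma coord_basis b c : coord (basis b) c = (c == b)%:R.
Proof. exact: ffunE. Qed.

Lemma scale_basis_inj s t b c :
  s != 0 -> s *: basis b = t *: basis c -> b = c.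
Proof.
move=> s0 /(congr1 (coord^~ b)); rewrite !coordZ !coord_basis eqxx mulr1.
by case: eqP => // _; rewrite mulr0 => /eqP; rewrite (negPf s0).
Qed.

(** Trading the sign for a nonzero scalar lets it pass through [J] and the bracket without a case
    split. *)
Lemma eq_upto_sign_scale (u v : g) :
  eq_upto_sign u v -> exists2 s : R, s != 0 & u = s *: v.
Proof.
case=> [->|<-]; first by exists 1; rewrite ?oner_eq0 ?scale1r.
by exists (-1); rewrite ?oppr_eq0 ?oner_eq0 // scaleN1r opprK.
Qed.

Lemma lie_basisP b c :
  lie (basis b) (basis c) = 0 \/
  exists i j (e : edge G), [/\ b = inl i, c = inl j, joins e i j
    & eq_upto_sign (lie (basis b) (basis c)) (basis (inr e))].
Proof.
have -> : lie (basis b) (basis c) = bracket_basis R b c.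
  exact: graph_bracket_bvec.
case: b c => [i|?] [j|?] /=; try by left.
case: insubP => [u _ e|_].
  by right; exists i, j, u; split=> //; left.
case: insubP => [u _ e|_]; last by left.
by right; exists i, j, u; split=> //; right=> //; apply: opprK.
Qed.

Lemma lie_joins (a : edge G) x y :
  joins a x y ->
  eq_upto_sign (lie (vvec R G x) (vvec R G y)) (basis (inr a)).
Proof.
have lieE : forall x y, lie (vvec R G x) (vvec R G y)
    = bracket_basis R (inl x : bidx G) (inl y).
  by move=> ? ?; apply: graph_bracket_bvec.
have Vlt i j : val a = (i, j) -> lie (vvec R G i) (vvec R G j) = basis (inr a).
  (* The pair [(i, j)] is [val a], so [insub] returns [a] itself. *)
  by move=> aij; rewrite lieE /= -aij valK.
case=> /Vlt E; [by left|right].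
by rewrite -E !lieE bracket_basis_anti opprK.
Qed.

(** Edges are central and brackets lie in the span of the edges. This is how [J x] or [J y] is
    recognised as a vertex, and [J a] as an edge, up to sign. *)
Lemma lie_basis_coord b c d :
  coord (lie (basis b) (basis c)) d != 0 ->
  exists i j (e : edge G), [/\ b = inl i, c = inl j, d = inr e & joins e i j].
Proof.
have [->|[i [j [e [-> -> eij /eq_upto_sign_scale[s _ ->]]]]]] := lie_basisP b c.
  by rewrite [coord _ _]ffunE eqxx.
rewrite coordZ coord_basis; have [->|_] := eqVneq d (inr e); last by rewrite mulr0 eqxx.
by move=> _; exists i, j, e.
Qed.

End Basis.

(** * Action of an adapted [J] on basis vectors *)

Section Adapted.
Variables (R : realType) (n : nat) (G : graph n).
Variable J : {linear graph_lie R G -> graph_lie R G}.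
Hypothesis hJ : adapted_complex_structure J.
Local Notation g := (graph_lie R G).
Local Notation basis := (@basis R n G).
Implicit Types (b c d : bidx G).

Let JJ (u : g) : J (J u) = - u. Proof. by case: hJ => -[]. Qed.

Lemma adapted_basis b : exists c, eq_upto_sign (J (basis b)) (basis c).
Proof. by case: hJ => _; apply. Qed.

Lemma J_basis_sym s b c :
  s != 0 -> J (basis b) = s *: basis c -> J (basis c) = - s^-1 *: basis b.
Proof.
move=> s0 Jb; rewrite scaleNr -scalerN -JJ Jb linearZ /= scalerA mulVf //.
by rewrite scale1r.
Qed.

(** Both [b] and [b'] are recovered, up to a nonzero scalar, from the image of [basis c] under
    [J]. *)
Lemma J_basis_inj s t b b' c : s != 0 -> t != 0 ->
  J (basis b) = s *: basis c -> J (basis b') = t *: basis c -> b = b'.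
Proof.
move=> s0 t0 /(J_basis_sym s0) Jc /(J_basis_sym t0); rewrite Jc.
by apply: scale_basis_inj; rewrite oppr_eq0 invr_eq0.
Qed.

(** Otherwise applying [J] twice gives [s * s = -1], impossible in an ordered field. *)
Lemma J_basis_neq s b c : J (basis b) = s *: basis c -> b <> c.
Proof.
move=> Jb ebc; subst c; have /(congr1 (@coord R n G ^~ b)) := JJ (basis b).
rewrite Jb linearZ /= Jb scalerA -scaleN1r !coordZ coord_basis eqxx !mulr1.
by move=> ss; have := sqr_ge0 s; rewrite expr2 ss ler0N1.
Qed.

(** The values of [J] enter through equations so that scaled basis vectors can be substituted for
    them. *)
Lemma integrable_J (u v u' v' w : g) :
  J u = u' -> J v = v' -> J (lie u v) = w ->
  w = lie u' v + lie u v' + J (lie u' v').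
Proof.
move=> <- <- <-.
have [[_ /(_ u v) N] _] := hJ; have := congr1 J N.
rewrite linear0 linearB linearD /= JJ => /eqP.
by rewrite subr_eq0 subr_eq => /eqP ->; rewrite addrC.
Qed.

(** The definition of [distinguished] admits no sign but either orientation of the edge. Adaptedness
    makes [s] a sign, and if [J x = - y] then [J y = x], so the reversed orientation serves. *)
Lemma joins_distinguished s (a : edge G) x y :
  joins a x y -> s != 0 -> J (vvec R G x) = s *: vvec R G y ->
  distinguished J a.
Proof.
move=> axy s0 Jx; have [c Jxc] := adapted_basis (inl x).
have [t t0 Jxt] := eq_upto_sign_scale Jxc.
have cE : c = inl y.
  by apply: (@scale_basis_inj R n G t s) => //; rewrite -Jxt -Jx.
move: Jxc; rewrite cE => -[Jxy|Jxy]; first by exists x, y.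
exists y, x; split; first exact: joins_sym.
by rewrite -[vvec _ _ y]Jxy linearN JJ opprK.
Qed.

(** The orientation witnessing [distinguished] may be opposite to [x], [y]; applying [J] once more
    then costs a sign, hence the scalar. *)
Lemma distinguished_scale (a : edge G) x y :
  joins a x y -> distinguished J a ->
  exists2 s : R, s != 0 & J (vvec R G x) = s *: vvec R G y.
Proof.
move=> axy [i [j [aij Jij]]].
have [[-> ->]|[ix jy]] := joins_ends aij axy.
  by exists 1; rewrite ?oner_eq0 ?scale1r.
exists (-1); rewrite ?oppr_eq0 ?oner_eq0 // ix jy Jij JJ scaleN1r //.
Qed.

Lemma J_edge (a : edge G) x y :
  joins a x y -> ~ distinguished J a ->
  exists b : edge G, eq_upto_sign (J (evec R a)) (evec R b) /\
    ((exists z, eq_upto_sign (J (vvec R G x)) (vvec R G z) /\ joins b y z) \/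
     (exists z, eq_upto_sign (J (vvec R G y)) (vvec R G z) /\ joins b x z)).
Proof.
move=> axy nda.
have [X hX] := adapted_basis (inl x); have [s s0 Jx] := eq_upto_sign_scale hX.
have [Y hY] := adapted_basis (inl y); have [t t0 Jy] := eq_upto_sign_scale hY.
have [d hd] := adapted_basis (inr a); have [r r0 Ja] := eq_upto_sign_scale hd.
have [k k0 Exy] := eq_upto_sign_scale (lie_joins R axy).
(* A nonzero bracket of [basis X] and [basis Y] is an edge [e] up to sign, and a nonzero coordinate
   of its image at [d] would force [e = a]. *)
have JXY0 : coord (J (lie (basis X) (basis Y))) d = 0.
  have [->|[i [j [e [EX EY eij /eq_upto_sign_scale[p _ ->]]]]]] :=
    lie_basisP R X Y; first by rewrite linear0 [LHS]ffunE.
  have [c /eq_upto_sign_scale[q q0 Je]] := adapted_basis (inr e).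
  rewrite linearZ /= Je !coordZ coord_basis.
  have [dc|_] := eqVneq d c; last by rewrite !mulr0.
  subst c; have [ea] := J_basis_inj q0 r0 Je Ja.
  (* Now [X] and [Y] are [x] and [y] in some order: [X = x] makes [x] a real eigenvector of [J], and
     [X = y] makes [a] distinguished. *)
  move: eij; rewrite ea => /(joins_ends axy) [[ix _]|[iy _]].
    by case: (J_basis_neq Jx); rewrite EX ix.
  by case: nda; apply: (joins_distinguished axy s0); move: Jx; rewrite EX iy.
have Jxy : J (lie (vvec R G x) (vvec R G y)) = k *: (r *: basis d).
  by rewrite Exy linearZ /= Ja.
have := congr1 (@coord R n G ^~ d) (integrable_J Jx Jy Jxy).
rewrite lieZl !lieZr lieZl 2!linearZ_LR.
rewrite !(coordD, coordZ) coord_basis eqxx mulr1 JXY0 !mulr0 addr0.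
(* The left side is now [k * r], which is nonzero, so one of the two remaining brackets has a
   nonzero coordinate at [d]. *)
have [->|Xy _] := eqVneq (coord (lie (basis X) (vvec R G y)) d) 0.
  have [->|xY _] := eqVneq (coord (lie (vvec R G x) (basis Y)) d) 0.
    by rewrite !mulr0 addr0 => /eqP; rewrite mulf_eq0 (negPf k0) (negPf r0).
  have [i [j [e [[ix] EY Ed eij]]]] := lie_basis_coord xY.
  exists e; split; first by rewrite Ed in hd.
  by right; exists j; split; [rewrite EY in hY | rewrite ix].
have [i [j [e [EX [jy] Ed eij]]]] := lie_basis_coord Xy.
exists e; split; first by rewrite Ed in hd.
left; exists i; split; first by rewrite EX in hX.
by rewrite jy; apply: joins_sym.
Qed.

(** If [b = a], then [a] is a real eigenvector of [J]. If [b] is distinguished, then [J y] and [J x]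
    are both multiples of [z], so [x = y] by injectivity. The shared endpoint is [y]. *)
Lemma J_edge_properties (a b : edge G) x y z :
  joins a x y -> eq_upto_sign (J (evec R a)) (evec R b) ->
  eq_upto_sign (J (vvec R G x)) (vvec R G z) -> joins b y z ->
  [/\ b <> a, ~ distinguished J b & edges_adjacent a b].
Proof.
move=> axy /eq_upto_sign_scale[r _ Ja] /eq_upto_sign_scale[s s0 Jx] byz.
split.
- by move=> ba; case: (J_basis_neq Ja); rewrite ba.
- move=> /(distinguished_scale byz) [t t0 Jy].
  have [yx] := J_basis_inj t0 s0 Jy Jx.
  by apply: (joins_neq axy); rewrite yx.
- exists y; split; last exact: joins_incident byz.
  exact: joins_incident (joins_sym axy).
Qed.

End Adapted.

Theorem proposition4p7 (R : realType) (n : nat) (G : graph n)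
    (J : {linear graph_lie R G -> graph_lie R G})
    (hJ : adapted_complex_structure J)
    (a : edge G) (x y : 'I_n)
    (hxy : joins a x y) (ha : ~ distinguished J a) :
  exists b : edge G,
    [/\ eq_upto_sign (J (evec R a)) (evec R b),
        b <> a,
        ~ distinguished J b &
        edges_adjacent a b] /\
    ((exists z : 'I_n,
        eq_upto_sign (J (vvec R G x)) (vvec R G z) /\ ~ isolated G z) \/
     (exists z : 'I_n,
        eq_upto_sign (J (vvec R G y)) (vvec R G z) /\ ~ isolated G z)) /\
    ((exists z : 'I_n,
        eq_upto_sign (J (vvec R G y)) (vvec R G z) /\ joins b x z) \/
     (exists z : 'I_n,
        eq_upto_sign (J (vvec R G x)) (vvec R G z) /\ joins b y z)).
Proof.
have [b [Ja [[z [Jx byz]]|[z [Jy bxz]]]]] := J_edge hJ hxy ha; exists b.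
  have [ba ndb adjab] := J_edge_properties hJ hxy Ja Jx byz.
  split=> //; split; last by right; exists z.
  by left; exists z; split=> //; apply: joins_not_isolated (joins_sym byz).
(* This is the previous case with [x] and [y] exchanged. *)
have [ba ndb adjab] := J_edge_properties hJ (joins_sym hxy) Ja Jy bxz.
split=> //; split; last by left; exists z.
by right; exists z; split=> //; apply: joins_not_isolated (joins_sym bxz).
Qed.
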